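(* Let $\mathcal A$, $\mathcal B$ be clones on sets $A$ and $B$, let $n\ge1$, and let $\mathcal A_{const}=\mathrm{Clo}(\mathcal A\cup\{a\}_{a\in A})$ be the clone generated by $\mathcal A$ and all constant operations on $A$. Let $\mathcal C$ be a clonoid from $\mathcal A_{const}$ to $\mathcal B$. Then the following are equivalent: (1) $\mathcal C^{(n+1)}$ is $(n,\mathcal A,\mathcal B)$-UG; (2) $\mathcal C^{(k)}$ is $(n,\mathcal A,\mathcal B)$-UG for some $k>n$; (3) $\mathcal C$ is $(n,\mathcal A,\mathcal B)$-UG; (4) for all $k,l\in\mathbb N$, every partial operation $I\colon\mathcal C^{(k)}\to\mathcal C^{(l)}$ that is $(\mathcal A,\mathcal B)$-UR is $(n,\mathcal A,\mathcal B)$-UR.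
   Context: $\mathbb N=\{1,2,\dots\}$. For sets $A,B$, $\mathcal O_{A,B}=\bigcup_{m\ge 1}B^{A^m}$; for $\mathcal C\subseteq\mathcal O_{A,B}$, $\mathcal C^{(m)}=\mathcal C\cap B^{A^m}$. A clone on $A$ is a set of finitary operations on $A$ containing all projections and closed under composition; $\mathrm{Clo}(F)$ is the smallest clone containing $F$. For clones $\mathcal A$ on $A$ and $\mathcal B$ on $B$, a clonoid from $\mathcal A$ to $\mathcal B$ is a set $\mathcal C\subseteq\mathcal O_{A,B}$ such that for all $m,p\in\mathbb N$: (i) $f_1,\dots,f_p\in\mathcal C^{(m)}$, $g\in\mathcal B^{(p)}$ imply $g\circ(f_1,\dots,f_p)\in\mathcal C^{(m)}$; (ii) $f\in\mathcal C^{(m)}$, $g_1,\dots,g_m\in\mathcal A^{(p)}$ imply $f\circ(g_1,\dots,g_m)\in\mathcal C^{(p)}$. For $k,l,n\in\mathbb N$, $R_n^{k,l}(\mathcal A)$ is the set of maps $r\colon A^k\to A^l$ of the form $r=v\circ w$ with $w\in(\mathcal A^{(k)})^n$ and $v\in(\mathcal A^{(n)})^l$ (a tuple of $l$ operations of arity $k$ is regarded as a map $A^k\to A^l$). A set $U\subseteq B^{A^k}$ is $(n,\mathcal A,\mathcal B)$-UG (uniformly generated by its $n$-ary $(\mathcal A,\mathcal B)$-minors) if there are $m\in\mathbb N$, $s\in\mathcal B^{(m)}$ and $r_1,\dots,r_m\in R_n^{k,k}(\mathcal A)$ such that $f=s\circ(f\circ r_1,\dots,f\circ r_m)$ for every $f\in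 U$. A set $U\subseteq\mathcal O_{A,B}$ is $(n,\mathcal A,\mathcal B)$-UG if $U^{(k)}$ is $(n,\mathcal A,\mathcal B)$-UG for every $k\in\mathbb N$. A partial operation $I\colon B^{A^k}\to B^{A^l}$ is $(n,\mathcal A,\mathcal B)$-UR (uniformly represented by $n$-ary $(\mathcal A,\mathcal B)$-minors) if there are $m\in\mathbb N$, $s\in\mathcal B^{(m)}$ and $r_1,\dots,r_m\in R_n^{l,k}(\mathcal A)$ such that $I(f)=s\circ(f\circ r_1,\dots,f\circ r_m)$ for all $f$ in the domain of $I$. It is $(\mathcal A,\mathcal B)$-UR if it is $(n,\mathcal A,\mathcal B)$-UR for some $n\in\mathbb N$. *)

(* Defs.v *)
From mathcomp Require Import all_boot.
From mathcomp Require Import boolp classical_sets.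

Set Implicit Arguments.
Unset Strict Implicit.
Unset Printing Implicit Defensive.

Local Open Scope classical_set_scope.

Definition op (A B : Type) (m : nat) : Type := ('I_m -> A) -> B.

(* A set C of finitary operations is given by its m-ary parts C m. Only
   positive arities are considered: every condition below carries a guard
   0 < m, and the component C 0 is never consulted. *)
Definition opset (A B : Type) : Type := forall m : nat, set (op A B m).

(* An l-tuple of k-ary operations, regarded as a map A^k -> B^l. *)
Definition tuple_map (A B : Type) (k l : nat) (w : 'I_l -> op A B k) :
  ('I_k -> A) -> ('I_l -> B) := fun x i => w i x.

Definition comp_op (A B D : Type) (m p : nat)
  (g : op B D p) (f : 'I_p -> op A B m) : op A D m := g \o tuple_map f.

Definition proj (A : Type) (m : nat) (i : 'I_m) : op A A m := fun x => x i.

Definition const_op (A : Type) (m : nat) (a : A) : op A A m := fun=> a.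

Definition clone (A : Type) (C : opset A A) : Prop :=
  (forall m : nat, 0 < m -> forall i : 'I_m, C m (proj i)) /\
  (forall m p : nat, 0 < m -> 0 < p ->
     forall (g : op A A p) (f : 'I_p -> op A A m),
     C p g -> (forall i, C m (f i)) -> C m (comp_op g f)).

Definition Clo (A : Type) (F : opset A A) : opset A A := fun m f =>
  forall C : opset A A, clone C ->
    (forall p : nat, 0 < p -> F p `<=` C p) -> C m f.

Definition with_consts (A : Type) (cA : opset A A) : opset A A :=
  Clo (fun m => cA m `|` range (@const_op A m)).

Definition clonoid (A B : Type) (cA : opset A A) (cB : opset B B)
  (C : opset A B) : Prop :=
  forall m p : nat, 0 < m -> 0 < p ->
    (forall (f : 'I_p -> op A B m) (g : op B B p),
       (forall i, C m (f i)) -> cB p g -> C m (comp_op g f)) /\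
    (forall (f : op A B m) (g : 'I_m -> op A A p),
       C m f -> (forall i, cA p (g i)) -> C p (comp_op f g)).

Definition Rmaps (A : Type) (cA : opset A A) (n k l : nat) :
  set (('I_k -> A) -> ('I_l -> A)) := fun r =>
  exists (w : 'I_n -> op A A k) (v : 'I_l -> op A A n),
    [/\ forall i, cA k (w i), forall j, cA n (v j)
      & r = tuple_map v \o tuple_map w].

Definition UG (A B : Type) (n : nat) (cA : opset A A) (cB : opset B B)
  (k : nat) (U : set (op A B k)) : Prop :=
  exists (m : nat) (s : op B B m) (r : 'I_m -> ('I_k -> A) -> ('I_k -> A)),
    [/\ 0 < m, cB m s, forall i, Rmaps cA n (r i)
      & forall f, U f -> f = comp_op s (fun i => f \o r i)].

Definition UG_all (A B : Type) (n : nat) (cA : opset A A) (cB : opset B B)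
  (U : opset A B) : Prop :=
  forall k : nat, 0 < k -> UG n cA cB (U k).

(* I f = Some g means that f is in the domain of I and that I(f) = g. *)
Definition partial_op (A B : Type) (k l : nat) : Type :=
  op A B k -> option (op A B l).

Definition partial_op_on (A B : Type) (k l : nat)
  (U : set (op A B k)) (V : set (op A B l)) (I : partial_op A B k l) : Prop :=
  forall f g, I f = Some g -> U f /\ V g.

Definition UR_n (A B : Type) (n : nat) (cA : opset A A) (cB : opset B B)
  (k l : nat) (I : partial_op A B k l) : Prop :=
  exists (m : nat) (s : op B B m) (r : 'I_m -> ('I_l -> A) -> ('I_k -> A)),
    [/\ 0 < m, cB m s, forall i, Rmaps cA n (r i)
      & forall f g, I f = Some g -> g = comp_op s (fun i => f \o r i)].

Definition UR (A B : Type) (cA : opset A A) (cB : opset B B)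
  (k l : nat) (I : partial_op A B k l) : Prop :=
  exists n : nat, 0 < n /\ UR_n n cA cB I.

(* Main.v *)
Require Import Defs.
From mathcomp Require Import all_boot.
From mathcomp Require Import boolp classical_sets.

(** The substance is (2) => (3).  Adding dummy variables to an [l]-ary function
    shows that uniform generation passes from arity [k] to every arity
    [l <= k].  Conversely, let [f] be [k.+1]-ary with [k > n].  Freezing one
    variable of [f] at a constant [a] gives a function in [C k]; as the
    generating identity of [C k] does not depend on [a], it describes [f] by
    minors through [A^(n+1)], the frozen variable being carried along.  These
    minors come from functions in [C n.+1], where [n+1 <= k], so they are in turn
    generated by their [n]-ary minors.  (4) => (1) applies (4) to the identity
    operation of [C n.+1]. *)

Set Implicit Arguments.
Unset Strict Implicit.
Unset Printing Implicit Defensive.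

Local Open Scope classical_set_scope.

Section Clones.
Variables (A : Type) (cA : opset A A).

(** Index the variables of [S] by pairs: [S] is [s] applied to m copies of [t] in disjoint
    variables. Thus one generating identity substituted into another is again a single identity of
    the required form. *)
Lemma clone_nested_comp (hA : clone cA) (m p : nat) (s : op A A m)
    (t : op A A p) :
  0 < m -> 0 < p -> cA s -> cA t ->
  exists (M : nat) (S : op A A M) (q : 'I_M -> 'I_m * 'I_p),
    [/\ 0 < M, cA S
      & forall y : 'I_m -> 'I_p -> A,
          S (fun i => y (q i).1 (q i).2) = s (fun j => t (y j))].
Proof.
move=> m0 p0 cs ct.
have M0 : 0 < #|{: 'I_m * 'I_p}| by rewrite card_prod !card_ord muln_gt0 m0.
exists #|{: 'I_m * 'I_p}|.
exists (comp_op s (fun j => comp_op t (fun i => proj (enum_rank (j, i))))).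
exists enum_val; split => //.
  by apply: hA.2 => // j; apply: hA.2 => // i; apply: hA.1.
move=> y; congr s; apply: funext => j; congr t; apply: funext => i.
by rewrite /tuple_map /proj enum_rankK.
Qed.

Lemma Rmaps_compl (hA : clone cA) (n k l p : nat)
    (r : ('I_k -> A) -> 'I_l -> A) (v : 'I_p -> op A A l) :
  0 < n -> 0 < l -> Rmaps cA n r -> (forall i, cA (v i)) ->
  Rmaps cA n (tuple_map v \o r).
Proof.
move=> n0 l0 [w [u [cw cu ->]]] cv; exists w, (fun i => comp_op (v i) u).
by split => // i; apply: hA.2.
Qed.

Lemma Rmaps_compr (hA : clone cA) (n k l p : nat)
    (r : ('I_k -> A) -> 'I_l -> A) (w : 'I_k -> op A A p) :
  0 < k -> 0 < p -> Rmaps cA n r -> (forall i, cA (w i)) ->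
  Rmaps cA n (r \o tuple_map w).
Proof.
move=> k0 p0 [u [v [cu cv ->]]] cw; exists (fun i => comp_op (u i) w), v.
by split => // i; apply: hA.2.
Qed.

Lemma Rmaps_id (hA : clone cA) (n : nat) :
  0 < n -> Rmaps cA n (@id ('I_n -> A)).
Proof.
by move=> n0; exists (@proj A n), (@proj A n); split => // i; apply: hA.1.
Qed.

Lemma with_consts_sub (m : nat) : 0 < m -> cA (m:=m) `<=` with_consts cA (m:=m).
Proof. by move=> m0 f cf C _ hC; apply: (hC m) => //; left. Qed.

Lemma with_consts_const (m : nat) (a : A) :
  0 < m -> with_consts cA (const_op (m:=m) a).
Proof. by move=> m0 C _ hC; apply: (hC m) => //; right; exists a. Qed.

End Clones.

Section ExtraCoordinate.
Variable A : Type.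

Definition cons_tuple (k : nat) (a : A) (x : 'I_k -> A) : 'I_k.+1 -> A :=
  fun i => oapp x a (unlift ord0 i).

Lemma cons_tupleK (k : nat) (x : 'I_k.+1 -> A) :
  cons_tuple (x ord0) (x \o lift ord0) = x.
Proof.
by apply: funext => i; rewrite /cons_tuple; case: unliftP => [j|] ->.
Qed.

(** The product of the identity of [A] with the map given by [w]. *)
Definition cons_ops (k l : nat) (w : 'I_l -> op A A k) : 'I_l.+1 -> op A A k.+1 :=
  fun i x => cons_tuple (x ord0) (tuple_map w (x \o lift ord0)) i.

Lemma cons_ops_clone (cA : opset A A) (hA : clone cA) (k l : nat)
    (w : 'I_l -> op A A k) :
  0 < k -> (forall i, cA k (w i)) -> forall i, cA k.+1 (cons_ops w i).
Proof.
move=> k0 cw i; rewrite /cons_ops /cons_tuple.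
case: unliftP => [j|] _ /=; last exact: hA.1.
apply: (hA.2 k.+1 k _ _ (w j) (fun i => proj (lift ord0 i))) => // ?.
exact: hA.1.
Qed.

(** Both factors of [r] are made to carry the extra coordinate, so the middle space A^n grows to
    A^(n+1). *)
Lemma Rmaps_cons (cA : opset A A) (hA : clone cA) (n k l : nat)
    (r : ('I_k -> A) -> 'I_l -> A) :
  0 < n -> 0 < k -> Rmaps cA n r ->
  Rmaps cA n.+1 (fun x => cons_tuple (x ord0) (r (x \o lift ord0))).
Proof.
move=> n0 k0 [w [v [cw cv ->]]]; exists (cons_ops w), (cons_ops v).
split; [exact: cons_ops_clone | exact: cons_ops_clone |].
apply: funext => x; congr cons_tuple.
  by rewrite /tuple_map /cons_ops /cons_tuple unlift_none.
congr (tuple_map v); apply: funext => j.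
by rewrite /= /tuple_map /cons_ops /cons_tuple liftK.
Qed.

End ExtraCoordinate.

Section UniformGeneration.
Variables (A B : Type) (cA : opset A A) (cB : opset B B).
Hypotheses (hA : clone cA) (hB : clone cB).

Lemma clonoid_without_consts (C : opset A B) :
  clonoid (with_consts cA) cB C -> clonoid cA cB C.
Proof.
move=> hC m p m0 p0; have [hl hr] := hC m p m0 p0; split => // f g cf cg.
by apply: hr => // i; apply: with_consts_sub.
Qed.

Lemma UG_leq (C : opset A B) (n k l : nat) :
  clonoid cA cB C -> 0 < n -> 0 < l -> l <= k ->
  UG n cA cB (C k) -> UG n cA cB (C l).
Proof.
move=> hC n0 l0 lk [m [s [r [m0 cs cr hr]]]].
have k0 := leq_trans l0 lk.
(* Indices from l on go to 0; any value would do, as [pad] need only be a left inverse of the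
   inclusion. *)
pose pad (i : 'I_k) : 'I_l := insubd (Ordinal l0) (i : nat).
have padK j : pad (widen_ord lk j) = j.
  by apply: val_inj; rewrite val_insubd /= ltn_ord.
pose res (j : 'I_l) := @proj A k (widen_ord lk j).
exists m, s, (fun i => tuple_map res \o (r i \o tuple_map (fun j => proj (pad j)))).
split => // [i|f Cf].
  apply: Rmaps_compl => //; last by move=> ?; apply: hA.1.
  by apply: Rmaps_compr => // ?; apply: hA.1.
have Cf' : C k (comp_op f res).
  by apply: (hC l k l0 k0).2 => // i; apply: hA.1.
apply: funext => x; have := congr1 (@^~ (x \o pad)) (hr _ Cf') => /= E.
rewrite -[RHS]E; congr f; apply: funext => j.
by rewrite /tuple_map /res /proj /= padK.
Qed.

Lemma UG_trans (C : opset A B) (n p k : nat) :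
  clonoid cA cB C -> 0 < n -> 0 < p -> 0 < k ->
  UG p cA cB (C k) -> UG n cA cB (C p) -> UG n cA cB (C k).
Proof.
move=> hC n0 p0 k0 [m [s [r [m0 cs cr hr]]]] [m' [s' [r' [m'0 cs' cr' hr']]]].
have [w cw] := choice cr; have [v cv] := choice cw.
have [M [S [q [M0 cS hS]]]] := clone_nested_comp hB m0 m'0 cs cs'.
exists M, S, (fun i => tuple_map (v (q i).1)
   \o (r' (q i).2 \o tuple_map (w (q i).1))); split => // [i|f Cf].
  have [cwi cvi _] := cv (q i).1.
  by apply: Rmaps_compl => //; apply: Rmaps_compr.
apply: funext => x; rewrite [LHS](congr1 (@^~ x) (hr _ Cf)).
rewrite /comp_op /= /tuple_map /=.
rewrite (hS (fun j i => f (tuple_map (v j) (r' i (tuple_map (w j) x))))).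
congr s; apply: funext => j; have [cwj cvj ->] := cv j.
(* Substituting [v j] in [f] gives a member of [C p], to which the generating identity of [C p]
   applies. *)
have Cfv : C p (comp_op f (v j)) by apply: (hC k p k0 p0).2.
exact: (congr1 (@^~ (tuple_map (w j) x)) (hr' _ Cfv)).
Qed.

Lemma UG_succ (C : opset A B) (n k : nat) :
  clonoid (with_consts cA) cB C -> 0 < n -> 0 < k ->
  UG n cA cB (C k) -> UG n.+1 cA cB (C k.+1).
Proof.
move=> hC n0 k0 [m [s [r [m0 cs cr hr]]]].
exists m, s, (fun i x => cons_tuple (x ord0) (r i (x \o lift ord0))).
split => // [i|f Cf]; first exact: Rmaps_cons.
apply: funext => x.
pose g (i : 'I_k.+1) : op A A k := fun y => cons_tuple (x ord0) y i.
have Cfg : C k (comp_op f g).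
  apply: (hC k.+1 k isT k0).2 => // i; rewrite /g /cons_tuple.
  case: unliftP => [j|] _ /=; last exact: with_consts_const.
  by apply: with_consts_sub => //; apply: hA.1.
have := congr1 (@^~ (x \o lift ord0)) (hr _ Cfg) => /= E.
by rewrite -[RHS]E -[in LHS](cons_tupleK x).
Qed.

Lemma UG_all_of_UG_succ (C : opset A B) (n : nat) :
  clonoid (with_consts cA) cB C -> 0 < n ->
  UG n cA cB (C n.+1) -> UG_all n cA cB C.
Proof.
move=> hC n0 ug l l0; have hC' := clonoid_without_consts hC.
have ugD d : UG n cA cB (C (d + n.+1)).
  elim: d => [//|d IH]; rewrite addSn.
  by apply: (UG_trans (p:=n.+1)) => //; apply: UG_succ => //; rewrite addnS.
(* Going up to arity l + (n+1) and back down to l avoids comparing l with n. *)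
by apply: (UG_leq _ _ _ _ (ugD l)) => //; apply: leq_addr.
Qed.

(** Values of [I] lie in [V], so the generating identity of [V] applies to them, and the
    representation of [I] is substituted into it. In each composite of some [r'] after some [r], the
    map [r] already passes through A^n and [r'] consists of operations of [cA], so the composite
    passes through A^n. *)
Lemma UR_of_UG (n k l : nat) (U : set (op A B k)) (V : set (op A B l))
    (I : partial_op A B k l) :
  0 < n -> 0 < l -> UG n cA cB V -> partial_op_on U V I ->
  UR cA cB I -> UR_n n cA cB I.
Proof.
move=> n0 l0 [m [s [r [m0 cs cr hr]]]] hI [p [p0 [m' [s' [r' [m'0 cs' cr' hr']]]]]].
have [M [S [q [M0 cS hS]]]] := clone_nested_comp hB m0 m'0 cs cs'.
exists M, S, (fun i => r' (q i).2 \o r (q i).1); split => // [i|f g Ifg].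
  have [w [v [cw cv ->]]] := cr' (q i).2.
  apply: (Rmaps_compl hA (v := fun j => comp_op (v j) w)) => // j.
  exact: hA.2.
have [_ Vg] := hI _ _ Ifg.
apply: funext => x; rewrite [LHS](congr1 (@^~ x) (hr _ Vg)).
rewrite /comp_op /= /tuple_map /= (hS (fun j i => f (r' i (r j x)))).
by congr s; apply: funext => j; rewrite {1}(hr' _ _ Ifg).
Qed.

End UniformGeneration.

Theorem theorem18 (A B : Type) (cA : opset A A) (cB : opset B B) (n : nat)
    (C : opset A B) (hA : clone cA) (hB : clone cB) (hn : 1 <= n)
    (hC : clonoid (with_consts cA) cB C) :
  [<-> UG n cA cB (C n.+1);
       exists k : nat, n < k /\ UG n cA cB (C k);
       UG_all n cA cB C;
       forall k l : nat, 0 < k -> 0 < l ->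
         forall I : partial_op A B k l, partial_op_on (C k) (C l) I ->
           UR cA cB I -> UR_n n cA cB I].
Proof.
tfae.
- by move=> ug; exists n.+1.
- move=> [k [nk ug]]; apply: UG_all_of_UG_succ => //.
  by apply: UG_leq ug => //; apply: clonoid_without_consts.
- by move=> ug k l k0 l0 I; apply: UR_of_UG => //; apply: ug.
- move=> ur; pose I (f : op A B n.+1) := if `[< C n.+1 f >] then Some f else None.
  have IP f g : I f = Some g -> C n.+1 f /\ g = f.
    by rewrite /I; case: asboolP => // Cf [<-].
  have [||||m [s [r [m0 cs cr hr]]]] := ur n.+1 n.+1 _ _ I => //.
  + by move=> f g /IP[Cf ->].
  (* The identity map of A^(n+1) factors through A^(n+1) by projections, so [I] is represented by
     (n+1)-ary minors. *)
  + exists n.+1; split => //; exists 1, (proj ord0), (fun _ x => x); split => //.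
    * exact: hB.1.
    * by move=> _; apply: Rmaps_id.
    * by move=> f g /IP[_ ->].
  + exists m, s, r; split => // f Cf; apply: hr.
    by rewrite /I; case: asboolP.
Qed.
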